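(* For each $\lambda\ge1$ there exists $\lambda'\ge1$ such that for each compact Riemannian $2$-manifold $X$ with intrinsic metric $d_g$ we have $$BL(X,d_g,\lambda)\subset\overline{R_{\mathrm{loc}}(X)\cap BL(X,d_g,\lambda')},$$ where the closure refers to the Gromov--Hausdorff distance.
   Context: A homeomorphism $f\colon(X,d_X)\to(Y,d_Y)$ is $\lambda$-bi-Lipschitz if $\lambda^{-1}d_X(x,y)\le d_Y(f(x),f(y))\le\lambda d_X(x,y)$ for all $x,y\in X$. For a metric space $(X,d)$ and $\lambda\ge1$, $BL(X,d,\lambda)$ is the collection of metric spaces $Y$ such that there exists a $\lambda$-bi-Lipschitz map from $(X,d)$ onto $Y$. Manifolds may have boundary and are connected, so that $d_g$ (the intrinsic metric of the given Riemannian metric $g$) is a finite metric. For a smooth manifold $X$, $R_{\mathrm{loc}}(X)$ is the collection of metrics $d$ on $X$ (identified with the metric spaces $(X,d)$) that are locally isometric to the intrinsic metric $d_{h}$ arising from some Riemannian metric $h$ on $X$; that is, the identity $(X,d_h)\to(X,d)$ is a local isometry: for every $x\in X$ there is $r>0$ such that the identity restricts to an isometric homeomorphism from $B_{d_h}(x,r)$ onto $B_d(x,r)$. A metric space lies in the closure of a collection if it is the Gromov--Hausdorff limit of a sequence of spaces in that collection. *)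

(* Defs.v *)
From HB Require Import structures.
From mathcomp Require Import all_boot all_order all_algebra.
From mathcomp Require Import all_classical all_reals all_analysis.

Set Implicit Arguments.
Unset Strict Implicit.
Unset Printing Implicit Defensive.

Import Order.TTheory GRing.Theory Num.Theory.
Import numFieldNormedType.Exports.

Local Open Scope classical_set_scope.
Local Open Scope ring_scope.

Section differentiability.
Context {R : realType} {V W : normedModType R}.

(* F is of class C^k on the open set U. *)
Fixpoint Ck (k : nat) (U : set V) (F : V -> W) : Prop :=
  if k is j.+1 then
    (forall x, U x -> differentiable F x) /\ forall v, Ck j U ('D_v F)
  else forall x, U x -> {for x, continuous F}.

Definition Cinfty (U : set V) (F : V -> W) : Prop := forall k, Ck k U F.

(* F extends f near x, from the set S to an open subset of V on which F has
   the regularity C. As usual on manifolds with boundary, differentiability on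
   a non-open set S (a relatively open subset of a half-space, a compact
   interval) means existence of such extensions at all points of S. *)
Definition local_extension (C : set V -> (V -> W) -> Prop) (S : set V)
    (f : V -> W) (x : V) (F : V -> W) : Prop :=
  exists U : set V,
    [/\ open U, U x, C U F & forall y, S y -> U y -> F y = f y].

Definition regular_on (C : set V -> (V -> W) -> Prop) (S : set V)
    (f : V -> W) : Prop :=
  forall x, S x -> exists F, local_extension C S f x F.

End differentiability.

Section manifold.
Context {R : realType} {n : nat}.

(* For n > 0 this is { x | 0 <= x_0 }. *)
Definition half_space : set 'rV[R]_n :=
  [set x | forall i : 'I_n, val i = 0%N -> 0 <= x 0 i].

(* A homeomorphism cmap, with inverse cinv, from an open subset cdom of X onto
   a relatively open subset cimg of the half-space. *)
Record chart (X : topologicalType) := Chart {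
  cdom : set X ;
  cimg : set 'rV[R]_n ;
  cmap : X -> 'rV[R]_n ;
  cinv : 'rV[R]_n -> X ;
  cdom_open : open cdom ;
  cimg_open : exists2 U : set 'rV[R]_n, open U & cimg = U `&` half_space ;
  cmap_img : forall p, cdom p -> cimg (cmap p) ;
  cinv_dom : forall x, cimg x -> cdom (cinv x) ;
  cmapK : forall p, cdom p -> cinv (cmap p) = p ;
  cinvK : forall x, cimg x -> cmap (cinv x) = x ;
  cmap_continuous : {within cdom, continuous cmap} ;
  cinv_continuous : {within cimg, continuous cinv} }.

Definition overlap (X : topologicalType) (c c' : chart X) : set 'rV[R]_n :=
  cimg c `&` cinv c @^-1` cdom c'.

Definition transition (X : topologicalType) (c c' : chart X) :
  'rV[R]_n -> 'rV[R]_n := cmap c' \o cinv c.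

End manifold.
Arguments chart R n X : clear implicits.
Arguments half_space R n : clear implicits.

(* Connected smooth n-manifolds, possibly with boundary. The atlas need not be
   maximal. *)
Record manifold (R : realType) (n : nat) := Manifold {
  mspace :> topologicalType ;
  atlas : set (chart R n mspace) ;
  mcover : forall p : mspace, exists c, atlas c /\ cdom c p ;
  mcompat : forall c c', atlas c -> atlas c' ->
    regular_on Cinfty (overlap c c') (transition c c') ;
  mhausdorff : hausdorff_space mspace ;
  mcountable : @second_countable mspace ;
  mconnected : connected [set: mspace] }.

Definition chart_at (R : realType) (n : nat) (X : manifold R n) (p : X) :
  chart R n X := sval (cid (mcover p)).

Section riemannian.
Context {R : realType} {n : nat}.

Definition qform (A : 'M[R]_n) (u v : 'rV[R]_n) : R := (u *m A *m v^T) 0 0.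

(* A smooth Riemannian metric, given by its coordinate matrices
   (g_ij) = gmat c on the image of each chart c of the atlas, subject to the
   transformation law of 2-tensors. The values of gmat elsewhere are junk.
   At boundary points the differential of a transition map is that of any
   smooth extension F. *)
Record riemannian (X : manifold R n) := Riemannian {
  gmat : chart R n X -> 'rV[R]_n -> 'M[R]_n ;
  gmat_smooth : forall c, atlas c -> regular_on Cinfty (cimg c) (gmat c) ;
  gmat_sym : forall c x, atlas c -> cimg c x -> (gmat c x)^T = gmat c x ;
  gmat_pos : forall c x u, atlas c -> cimg c x -> u != 0 ->
    0 < qform (gmat c x) u u ;
  gmat_compat : forall c c' x F, atlas c -> atlas c' -> overlap c c' x ->
    local_extension Cinfty (overlap c c') (transition c c') x F ->
    forall u v, qform (gmat c x) u v =
      qform (gmat c' (transition c c' x)) ('D_u F x) ('D_v F x) }.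

Context {X : manifold R n}.

Definition C1_curve (S : set R) (gamma : R -> X) : Prop :=
  {within S, continuous gamma} /\
  forall c, atlas c ->
    regular_on (@Ck R R^o _ 1) (S `&` gamma @^-1` cdom c) (cmap c \o gamma).

(* s lists the break points. *)
Definition piecewise_C1_curve (a b : R) (gamma : R -> X) : Prop :=
  {within `[a, b], continuous gamma} /\
  exists s : seq R, forall c d, a <= c -> c < d -> d <= b ->
    (forall t, t \in s -> ~~ (c < t < d)) -> C1_curve `[c, d] gamma.

(* The g-norm of the velocity, computed in one chart around gamma t; by
   gmat_compat the choice of the chart is immaterial wherever gamma is
   differentiable, hence at all but finitely many times. *)
Definition speed (g : riemannian X) (gamma : R -> X) (t : R) : R :=
  let c := chart_at (gamma t) in
  let v := 'D_(1 : R^o) (cmap c \o gamma : R^o -> 'rV[R]_n) t in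
  Num.sqrt (qform (gmat g c (cmap c (gamma t))) v v).

Definition curve_length (g : riemannian X) (a b : R) (gamma : R -> X) : R :=
  \int[@lebesgue_measure R]_(t in `[a, b]) speed g gamma t.

Definition intrinsic_dist (g : riemannian X) (x y : X) : R :=
  inf [set l | exists a b gamma,
    [/\ a <= b, piecewise_C1_curve a b gamma, gamma a = x, gamma b = y
      & l = curve_length g a b gamma]].

End riemannian.

Record metric_on (R : realType) (T : Type) := MetricOn {
  mfun :> T -> T -> R ;
  mfunxx : forall x, mfun x x = 0 ;
  mfun_pos : forall x y, mfun x y = 0 -> x = y ;
  mfunC : forall x y, mfun x y = mfun y x ;
  mfun_triangle : forall y x z, mfun x z <= mfun x y + mfun y z }.

(* The metric space (T, d), with the topology induced by d; any topology that T
   itself carries is forgotten. *)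
Definition metrized (R : realType) (T : choiceType) (d : metric_on R T) :
  Type := T.

HB.instance Definition _ (R : realType) (T : choiceType) (d : metric_on R T) :=
  Choice.copy (metrized d) T.

HB.instance Definition _ (R : realType) (T : choiceType) (d : metric_on R T) :=
  isMetric.Build R (metrized d) (mfunxx d) (@mfun_pos _ _ d) (mfunC d)
    (@mfun_triangle _ _ d).

Section collections.
Context {R : realType}.

Definition dist_continuous (A B : Type) (dA : A -> A -> R) (dB : B -> B -> R)
    (f : A -> B) : Prop :=
  forall x (e : R), 0 < e ->
    exists2 r : R, 0 < r & forall y, dA x y < r -> dB (f x) (f y) < e.

Definition dist_homeomorphism (A B : Type) (dA : A -> A -> R)
    (dB : B -> B -> R) (f : A -> B) : Prop :=
  exists f' : B -> A, [/\ cancel f f', cancel f' f,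
    dist_continuous dA dB f & dist_continuous dB dA f'].

Definition biLipschitz (A B : Type) (dA : A -> A -> R) (dB : B -> B -> R)
    (lambda : R) (f : A -> B) : Prop :=
  dist_homeomorphism dA dB f /\
  forall x y, lambda^-1 * dA x y <= dB (f x) (f y) <= lambda * dA x y.

(* Collections of metric spaces are predicates on metricType R, which lives in
   a universe too large for the type constructor set. *)
Definition BL (A : Type) (dA : A -> A -> R) (lambda : R) (Y : metricType R) :
    Prop :=
  exists f : A -> Y, biLipschitz dA mdist lambda f.

(* The identity (A, dh) -> (A, d) restricts, around each point, to a bijective
   isometry (in particular a homeomorphism) between the balls of a common
   radius: the two balls are the same subset of A and the distances agree. *)
Definition id_local_isometry (A : Type) (dh d : A -> A -> R) : Prop :=
  forall x, exists2 r : R, 0 < r &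
    [set y | dh x y < r] = [set y | d x y < r] /\
    forall y z, dh x y < r -> dh x z < r -> d y z = dh y z.

Definition Rloc (n : nat) (X : manifold R n) (Y : metricType R) : Prop :=
  exists d : metric_on R X,
    (exists h : riemannian X, id_local_isometry (intrinsic_dist h) d) /\
    Y = metrized d :> metricType R.

Definition isometric_embedding (A Z : metricType R) (i : A -> Z) : Prop :=
  forall x y, mdist (i x) (i y) = mdist x y.

Definition hausdorff_dist (Z : metricType R) (A B : set Z) : \bar R :=
  ereal_inf [set r%:E | r in [set r : R | [/\ 0 < r,
    forall a, A a -> exists2 b, B b & mdist a b < r &
    forall b, B b -> exists2 a, A a & mdist a b < r]]].

Definition GH_dist (A B : metricType R) : \bar R :=
  ereal_inf [set r | exists (Z : metricType R) (i : A -> Z) (j : B -> Z),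
    [/\ isometric_embedding i, isometric_embedding j &
      r = hausdorff_dist (range i) (range j)]].

Definition GH_closure (C : metricType R -> Prop) (Y : metricType R) : Prop :=
  exists u : nat -> metricType R,
    (forall k, C (u k)) /\ GH_dist (u k) Y @[k --> \oo] --> 0%E.

End collections.

(* Main.v *)
(* Let f : X -> Y be lambda-bi-Lipschitz, d the pullback of the metric of Y and
   L = lambda d_g, the intrinsic metric of lambda^2 g, so that
   d <= L <= lambda^2 d. For a maximal e-separated set N of (X, d), let d' be
   the largest metric with d' <= L everywhere and d' <= d on N. Then
   d <= d' <= L, so d' is again lambda-bi-Lipschitz to d_g, and d' - d = O(e)
   since N is an e-net. A shortcut between distinct points of N has length at
   least e, hence d' = L at scales below e: d' is locally isometric to L. *)

(* The factor [lambda] in [L] makes [L] dominate [d], so a path with a shortcut is never shorter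
   than [d], and [lambda' = lambda] suffices. The error is at most [2 * (1 + lambda ^+ 2) * e], and
   an explicit metric on two copies of X turns it into a bound on the Gromov-Hausdorff distance.
   Most of the work lies in showing that [L] is a metric. Definiteness, vanishing on the diagonal
   and the existence of joining curves are read off the map [f]; symmetry and the triangle
   inequality come from reversing and concatenating curves. Two obstacles arise there. [speed] uses
   a chart chosen separately at each point, so its measurability is not established and lengths are
   handled as lower integrals. Moreover, infinite integrals, missing derivatives and empty infima
   have default values, and every identity has to survive them. *)
Require Import Defs.
From HB Require Import structures.
From mathcomp Require Import all_boot all_order all_algebra.
From mathcomp Require Import all_classical all_reals all_analysis.
From mathcomp Require Import measurable_realfun.
From mathcomp Require Import ring lra.
Set Implicit Arguments.
Unset Strict Implicit.
Unset Printing Implicit Defensive.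
Import Order.TTheory GRing.Theory Num.Theory.
Import numFieldNormedType.Exports.
Local Open Scope classical_set_scope.
Local Open Scope ring_scope.

(** * Lower integrals *)

(* Nonnegative functions are not assumed measurable below: [integral] is then
   the lower integral, a supremum of integrals of simple functions. *)
Section lower_integral.
Context d (T : measurableType d) (R : realType).
Variable mu : {measure set T -> \bar R}.
Local Open Scope ereal_scope.
Import HBNNSimple.

Lemma sintegral_le_integral (D : set T) (f : T -> \bar R)
    (h : {nnsfun T >-> R}) :
  (forall x, 0 <= f x) -> (forall x, (h x)%:E <= (f \_ D) x) ->
  sintegral mu h <= \int[mu]_(x in D) f x.
Proof.
by move=> f0 hf; rewrite ge0_integralE//; apply: ereal_sup_ubound; exists h.
Qed.

Lemma integral_le_sintegral (D : set T) (f : T -> \bar R) (y : \bar R) :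
  (forall x, 0 <= f x) ->
  (forall h : {nnsfun T >-> R}, (forall x, (h x)%:E <= (f \_ D) x) ->
    sintegral mu h <= y) ->
  \int[mu]_(x in D) f x <= y.
Proof.
move=> f0 hy; rewrite ge0_integralE//; apply: ge_ereal_sup => _ /= [h hf <-].
exact: hy.
Qed.

(** Only the simple function below [f] is cut along [A], [B] and [N], so these sets have to be
    measurable, but neither the functions nor [D], [D1], [D2] do. The piece on the null set [N]
    integrates to 0. *)
Lemma ge0_lower_integral_cover (D A B N D1 D2 : set T) (f g1 g2 : T -> \bar R) :
  (forall x, 0 <= f x) -> (forall x, 0 <= g1 x) -> (forall x, 0 <= g2 x) ->
  measurable A -> measurable B -> measurable N -> mu N = 0 ->
  D `<=` A `|` B `|` N -> A `<=` D1 -> B `<=` D2 ->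
  (forall x, A x -> f x <= g1 x) -> (forall x, B x -> f x <= g2 x) ->
  \int[mu]_(x in D) f x <= \int[mu]_(x in D1) g1 x + \int[mu]_(x in D2) g2 x.
Proof.
move=> f0 g10 g20 mA mB mN N0 DABN AD1 BD2 fg1 fg2.
have erestrictE g (E : set T) x : E x -> (g \_ E) x = g x :> \bar R.
  by move=> Ex; rewrite patchT// inE.
have fD x : (f \_ D) x <= f x by rewrite /patch; case: ifP.
have indicNE (E : set T) (mE : measurable E) x : ~ E x -> mindic R mE x = 0%R.
  by move=> Ex; rewrite mindicE memNset.
have indicTE (E : set T) (mE : measurable E) x : E x -> mindic R mE x = 1%R.
  by move=> Ex; rewrite mindicE mem_set.
have hE g (C E : set T) (h : {nnsfun T >-> R}) (mC : measurable C) :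
    (forall x, 0 <= g x) -> C `<=` E -> (forall x, C x -> f x <= g x) ->
    (forall x, (h x)%:E <= (f \_ D) x) ->
    sintegral mu (proj_nnsfun h mC) <= \int[mu]_(x in E) g x.
  move=> g0 CE fg hf; apply: sintegral_le_integral => // x /=.
  have [Cx|nCx] := pselect (C x).
    rewrite indicTE// mulr1 erestrictE; last exact: CE.
    exact: le_trans (hf x) (le_trans (fD x) (fg _ Cx)).
  by rewrite indicNE// mulr0 erestrict_ge0.
apply: integral_le_sintegral => // h hf.
(* The three sets may overlap, so the pieces add up to at least [h]; off [D], [h] is at most 0. *)
have /le_trans-> // : sintegral mu h <= sintegral mu
    (add_nnsfun (add_nnsfun (proj_nnsfun h mA) (proj_nnsfun h mB))
                (proj_nnsfun h mN)).
  apply: le_sintegral => x /=.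
  have h0 : (0 <= h x)%R by [].
  have i0 (E : set T) (mE : measurable E) : (0 <= mindic R mE x)%R.
    by rewrite mindicE.
  have [Dx|nDx] := pselect (D x); last first.
    have := hf x; rewrite patchN ?notin_setE// lee_fin => hx0.
    by rewrite (le_trans hx0)// !addr_ge0// mulr_ge0.
  have [[|]|] := DABN _ Dx => Ex.
  - by rewrite (indicTE _ mA)// mulr1 -addrA lerDl addr_ge0// mulr_ge0.
  - by rewrite (indicTE _ mB)// mulr1 addrAC lerDr addr_ge0// mulr_ge0.
  - by rewrite (indicTE _ mN)// mulr1 lerDr addr_ge0// mulr_ge0.
rewrite 2!sintegralD//.
have -> : sintegral mu (proj_nnsfun h mN) = 0.
  transitivity (\int[mu]_(x in N) (h x)%:E).
    by rewrite integral_nnsfun//; apply: eq_sintegral => x; rewrite mrestrict.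
  apply: null_set_integral => //.
  exact/measurable_EFinP/measurable_funTS.
by rewrite adde0 leeD//; apply: hE.
Qed.

(** Scaling by the inverse constant carries simple functions below [c * g] to simple functions below
    [g]. This gives one inequality for every positive constant; the other is the same inequality for
    [k^-1]. *)
Lemma ge0_lower_integralZl (D : set T) (f : T -> \bar R) (k : R) :
  (0 < k)%R -> (forall x, 0 <= f x) ->
  \int[mu]_(x in D) (k%:E * f x) = k%:E * \int[mu]_(x in D) f x.
Proof.
have le (g : T -> \bar R) (c : R) : (0 < c)%R -> (forall x, 0 <= g x) ->
    \int[mu]_(x in D) (c%:E * g x) <= c%:E * \int[mu]_(x in D) g x.
  move=> c0 g0; have cV0 : (0 <= c^-1)%R by rewrite invr_ge0 ltW.
  have cV : c%:E * c^-1%:E = 1 by rewrite -EFinM divff// gt_eqF.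
  apply: integral_le_sintegral => [x|h hg].
    by rewrite mule_ge0// lee_fin ltW.
  rewrite -[leLHS]mul1e -cV -muleA lee_pmul2l//= -sintegralrM.
  apply: (sintegral_le_integral (h := scale_nnsfun h cV0)) => // x /=.
  have := hg x; rewrite /patch; case: ifP => _; last first.
    rewrite !lee_fin => hx0; exact: mulr_ge0_le0.
  move=> hx; rewrite EFinM -[leRHS]mul1e -cV [c%:E * _]muleC -muleA.
  by rewrite lee_wpmul2l// lee_fin.
move=> k0 f0; apply/eqP; rewrite eq_le le//=.
have kV : k%:E * k^-1%:E = 1 by rewrite -EFinM divff// gt_eqF.
rewrite -[leRHS]mul1e -kV -muleA lee_pmul2l//=.
apply: le_trans (le _ _ _ _); rewrite ?invr_gt0//; last first.
  by move=> x; rewrite mule_ge0// lee_fin ltW.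
by under [leRHS]eq_integral do rewrite muleA -EFinM mulVf ?gt_eqF// mul1e.
Qed.

(** Composition with [phi] keeps a simple function simple and preserves the measures of its level
    sets. One inequality is enough, since applying it again to the transported data undoes [phi]. *)
Lemma ge0_lower_integral_involutive (D : set T) (f : T -> \bar R)
    (phi : T -> T) :
  measurable_fun setT phi -> involutive phi ->
  (forall A, measurable A -> mu (phi @^-1` A) = mu A) ->
  (forall x, 0 <= f x) ->
  \int[mu]_(x in phi @^-1` D) f (phi x) = \int[mu]_(x in D) f x.
Proof.
move=> mphi phiK muphi f0.
have le (E : set T) (g : T -> \bar R) : (forall x, 0 <= g x) ->
    \int[mu]_(x in phi @^-1` E) g (phi x) <= \int[mu]_(x in E) g x.
  move=> g0; apply: integral_le_sintegral => // h hg.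
  have mh : measurable_fun setT (h \o phi) by exact: measurableT_comp.
  have fh : finite_set (range (h \o phi)).
    apply: (sub_finite_set _ (fimfunP h)) => _ [x _ <-] /=.
    by exists (phi x).
  have h0 x : (0 <= (h \o phi) x)%R by exact: fun_ge0.
  pose Mh := isMeasurableFun.Build _ _ _ _ (h \o phi) mh.
  pose Fh := FiniteImage.Build _ _ (h \o phi) fh.
  pose Nh := isNonNegFun.Build _ _ (h \o phi) h0.
  pose k : {nnsfun T >-> R} := HB.pack (h \o phi) Mh Fh Nh.
  have -> : sintegral mu h = sintegral mu k.
    rewrite !sintegralET; apply: eq_fsbigr => r _ /=; congr (_ * _).
    by rewrite comp_preimage muphi//.
  apply: sintegral_le_integral => // x /=.
  have := hg (phi x); rewrite /patch phiK.
  suff -> : (phi x \in phi @^-1` E) = (x \in E) by [].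
  by apply/idP/idP; rewrite !inE /= phiK.
apply/eqP; rewrite eq_le le//=.
have := le (phi @^-1` D) (f \o phi) (fun x => f0 _).
rewrite [X in integral _ X _](_ : _ = D); last first.
  by apply/seteqP; split => x /=; rewrite phiK.
by under eq_integral do rewrite /= phiK.
Qed.

End lower_integral.

(** * Lengths of curves *)

Section reflection.
Context {R : realType}.

(** The parameter [s] stays free for two uses: [s = a + b] reverses a curve on its own interval,
    while other values also move the interval. *)
Definition mirror (s t : R) : R := s - t.

Lemma mirrorK (s : R) : involutive (mirror s).
Proof. by move=> t; rewrite /mirror subKr. Qed.

Lemma mirror_itv (s a b : R) :
  mirror s @^-1` `[a, b] = `[s - b, s - a]%classic.
Proof.
apply/funext => t; apply/propext; rewrite /= /mirror !in_itv /=.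
rewrite lerBrDl lerBlDl [s - b <= t]lerBlDr [t <= s - a]lerBrDr.
by rewrite andbC [t + a]addrC.
Qed.

Lemma mirror_continuous (s : R) : continuous (mirror s).
Proof. by move=> t; apply: cvgB; [exact: cvg_cst|exact: cvg_id]. Qed.

Lemma measurable_mirror (s : R) :
  measurable_fun [set: measurableTypeR R] (mirror s : _ -> measurableTypeR R).
Proof. by apply: continuous_measurable_fun; exact: mirror_continuous. Qed.

(** The pushforward under the reflection agrees with Lebesgue measure on half-open intervals, up to
    which end is open, and uniqueness of the measure does the rest. *)
Lemma lebesgue_measure_mirror (s : R) (A : set (measurableTypeR R)) :
  measurable A -> lebesgue_measure (mirror s @^-1` A) = lebesgue_measure A.
Proof.
move=> mA; apply/esym.
pose phi : measurableTypeR R -> measurableTypeR R := mirror s.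
pose Ph := isMeasurableFun.Build _ _ _ _ phi (measurable_mirror s).
pose f : {mfun measurableTypeR R >-> measurableTypeR R} := HB.pack phi Ph.
apply: (lebesgue_measure_unique (mu := pushforward lebesgue_measure f)) => //.
move=> _ [[a b] /= _ <-]; rewrite /pushforward.
have -> : f @^-1` `]a, b] = `[s - b, s - a[%classic.
  apply/funext => t; apply/propext; rewrite /= /phi /mirror !in_itv /=.
  rewrite ltrBrDl lerBlDl [s - b <= t]lerBlDr [t < s - a]ltrBrDr.
  by rewrite andbC [t + a]addrC.
rewrite !lebesgue_measure_itv /= !lte_fin ltrD2l ltrN2.
by case: ifP => // _; rewrite -!EFinB; congr _%:E; ring.
Qed.

Context {W : normedModType R}.

Lemma derive_mirror (s : R) (F : R^o -> W) (v t : R^o) :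
  'D_v (F \o mirror s) t = 'D_(- v) F (mirror s t).
Proof.
rewrite /derive; apply: (congr1 (fun q => lim (q @ 0^'))); apply/funext => h /=.
by rewrite /mirror; congr (_ *: (F _ - _)); rewrite scalerN; ring.
Qed.

Lemma Ck_mirror (s : R) k (U : set R^o) (F : R^o -> W) :
  Ck k U F -> Ck k (mirror s @^-1` U) (F \o mirror s).
Proof.
elim: k F => [|k IH] F /= => [cF x Ux|[dF kF]].
  by apply: continuous_comp (cF _ Ux); exact: mirror_continuous.
split=> [x Ux|v].
  apply: differentiable_comp (dF _ Ux).
  by apply: differentiableB; exact: ex_diff.
rewrite (_ : 'D_v _ = 'D_(- v) F \o mirror s); first exact: IH.
by apply/funext => t; rewrite derive_mirror.
Qed.

End reflection.

(* Outside derivability points both sides are junk values of [lim]. *)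
Lemma deriveNdir_cases (R : realType) (V W : normedModType R)
    (F : V -> W) (v x : V) :
  'D_(- v) F x = - 'D_v F x \/ 'D_(- v) F x = 'D_v F x.
Proof.
pose q u (h : R) := h^-1 *: ((F \o shift x) (h *: u) - F x).
have qN u : q (- u) = -%R \o q u \o -%R.
  by apply/funext => h; rewrite /q /= scalerN scaleNr invrN scaleNr opprK.
have cvgN u l : q u h @[h --> 0^'] --> l -> q (- u) h @[h --> 0^'] --> - l.
  move=> ql; rewrite qN; apply: cvgN.
  apply: cvg_comp ql => A [e e0 eA]; exists e => // h /=.
  rewrite sub0r normrN => he h0; apply: eA => /=.
    by rewrite sub0r opprK.
  by rewrite oppr_eq0.
have [cv|ncv] := pselect (derivable F x v).
  by left; apply: (cvg_lim (@norm_hausdorff _ _)); exact: cvgN cv.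
right.
have ncv' : ~ derivable F x (- v).
  by move=> /cvgN; rewrite opprK => h; apply: ncv; apply/cvg_ex;
    exists (- 'D_(- v) F x).
by rewrite /derive (dvgP ncv) (dvgP ncv').
Qed.

Section curves.
Context {R : realType} {n : nat} {X : manifold R n}.
Implicit Types (S : set R) (gamma : R -> X).

Lemma C1_curve_eq S gamma gamma' : (forall t, S t -> gamma t = gamma' t) ->
  C1_curve S gamma -> C1_curve S gamma'.
Proof.
move=> eqg [cg dg]; split.
  by apply: subspace_eq_continuous cg => t; rewrite inE => /eqg.
move=> c ac t [St /= ct].
have [|F [U [oU Ut CF eqF]]] := dg c ac t; first by split=> //=; rewrite eqg.
exists F, U; split=> // y [Sy /= cy] Uy.
by rewrite eqF// -?eqg//; split=> //=; rewrite eqg.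
Qed.

Lemma within_continuous_mirror (s : R) S gamma : {within S, continuous gamma} ->
  {within mirror s @^-1` S, continuous (gamma \o mirror s)}.
Proof.
move=> /subspace_continuousP cg; apply/subspace_continuousP => t /= St.
apply: cvg_comp (cg _ St) => A /= SA.
exact: (@mirror_continuous _ s t _ SA).
Qed.

Lemma C1_curve_mirror (s : R) S gamma :
  C1_curve S gamma -> C1_curve (mirror s @^-1` S) (gamma \o mirror s).
Proof.
move=> [cg dg]; split; first exact: within_continuous_mirror.
move=> c ac t St; have [F [U [oU Ut CF eqF]]] := dg c ac _ St.
exists (F \o mirror s), (mirror s @^-1` U); split => //.
- by apply: open_comp oU => x _; exact: mirror_continuous.
- exact: Ck_mirror.
- by move=> y; exact: eqF.
Qed.

Lemma piecewise_C1_curve_mirror (s a b : R) gamma :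
  piecewise_C1_curve a b gamma ->
  piecewise_C1_curve (s - b) (s - a) (gamma \o mirror s).
Proof.
move=> [cg [l lg]]; split.
  by rewrite -mirror_itv; exact: within_continuous_mirror.
exists (map (mirror s) l) => c d bc cd da bk.
have -> : `[c, d]%classic = mirror s @^-1` `[mirror s d, mirror s c].
  by rewrite mirror_itv /mirror !subKr.
apply: C1_curve_mirror; apply: lg; rewrite /mirror; [lra|lra|lra|].
move=> t tl; have := bk _ (map_f _ tl); apply: contra => /andP[h1 h2].
by rewrite /mirror; apply/andP; split; lra.
Qed.

Lemma piecewise_C1_curve_concat (a b c : R) gamma1 gamma2 :
  a <= b -> b <= c -> gamma1 b = gamma2 b ->
  piecewise_C1_curve a b gamma1 -> piecewise_C1_curve b c gamma2 ->
  piecewise_C1_curve a c (fun t => if t <= b then gamma1 t else gamma2 t).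
Proof.
move=> ab bc gb [c1 [l1 pw1]] [c2 [l2 pw2]]; set gamma := fun t => _.
have g1 t : t <= b -> gamma1 t = gamma t by rewrite /gamma => ->.
have g2 t : b <= t -> gamma2 t = gamma t.
  rewrite /gamma le_eqVlt => /orP[/eqP<-|]; first by rewrite lexx gb.
  by rewrite ltNge => /negbTE ->.
split.
  rewrite (_ : `[a, c]%classic = `[a, b] `|` `[b, c]); last first.
    apply/seteqP; split=> t /=; rewrite !in_itv /=.
      move=> /andP[h1 h2]; case: (leP t b) => tb.
        by left; rewrite h1.
      by right; rewrite h2 ltW.
    by move=> [|] /andP[h1 h2]; apply/andP; split=> //; lra.
  apply: withinU_continuous; [exact: itv_closed|exact: itv_closed| |].
    apply: subspace_eq_continuous c1 => t; rewrite inE /= in_itv /= => /andP[_].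
    exact: g1.
  apply: subspace_eq_continuous c2 => t; rewrite inE /= in_itv /= => /andP[+ _].
  exact: g2.
(* With [b] among the break points, an interval without interior break points lies on one side of
   [b], where [gamma] is one of the two curves. *)
exists (b :: l1 ++ l2) => u v au uv vc bk.
have [vb|bv] := leP v b.
  apply: C1_curve_eq (pw1 u v au uv vb _) => [t /=|t tl].
    by rewrite in_itv /= => /andP[_ tv]; apply: g1; exact: le_trans vb.
  by apply: bk; rewrite inE mem_cat tl orbT.
have bu : b <= u.
  have := bk b (mem_head _ _); rewrite bv andbT -leNgt.
  exact.
apply: C1_curve_eq (pw2 u v bu uv vc _) => [t /=|t tl].
  by rewrite in_itv /= => /andP[ut _]; apply: g2; exact: le_trans ut.
by apply: bk; rewrite inE mem_cat tl !orbT.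
Qed.

End curves.

Section length.
Context {R : realType} {n : nat} {X : manifold R n} (g : riemannian X).
Implicit Types (gamma : R -> X) (x y z : X).

Lemma qformN (A : 'M[R]_n) (v : 'rV[R]_n) : qform A (- v) (- v) = qform A v v.
Proof. by rewrite /qform linearN mulNmx mulmxN mulNmx opprK. Qed.

(** The quadratic form is even, so both outcomes of [deriveNdir_cases] give the same speed; the
    identity thus holds even at times without a derivative. *)
Lemma speed_mirror (s t : R) gamma :
  speed g (gamma \o mirror s) t = speed g gamma (mirror s t).
Proof.
rewrite /speed /=; set c := chart_at _; rewrite compA derive_mirror.
by have [->|->] := deriveNdir_cases (cmap c \o gamma : R^o -> _) 1 (mirror s t);
  rewrite ?qformN.
Qed.

Lemma near_eq_speed (t : R) gamma gamma' : (\near t, gamma t = gamma' t) ->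
  speed g gamma t = speed g gamma' t.
Proof.
move=> eqg; rewrite /speed (nbhs_singleton eqg); set c := chart_at _.
have -> // : 'D_(1 : R^o) (cmap c \o gamma : R^o -> 'rV[R]_n) t =
  'D_(1 : R^o) (cmap c \o gamma' : R^o -> 'rV[R]_n) t.
apply: near_eq_derive; apply: filterS eqg => u /= ->.
by [].
Qed.

Lemma curve_length_ge0 (a b : R) gamma : 0 <= curve_length g a b gamma.
Proof.
by apply: fine_ge0; apply: integral_ge0 => t _; rewrite lee_fin sqrtr_ge0.
Qed.

Definition ecurve_length (D : set R) gamma : \bar R :=
  (\int[@lebesgue_measure R]_(t in D) (speed g gamma t)%:E)%E.

Lemma curve_lengthE (a b : R) gamma :
  curve_length g a b gamma = fine (ecurve_length `[a, b] gamma).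
Proof. by []. Qed.

Lemma ecurve_length_mirror (s : R) (D : set R) gamma :
  ecurve_length (mirror s @^-1` D) (gamma \o mirror s) = ecurve_length D gamma.
Proof.
transitivity (\int[@lebesgue_measure R]_(t in mirror s @^-1` D)
    (speed g gamma (mirror s t))%:E)%E.
  by apply: eq_integral => t _; rewrite speed_mirror.
apply: (@ge0_lower_integral_involutive _ _ _ (@lebesgue_measure R) D
  (fun t => (speed g gamma t)%:E) (mirror s)).
- exact: measurable_mirror.
- exact: mirrorK.
- exact: lebesgue_measure_mirror.
- by move=> t; rewrite lee_fin sqrtr_ge0.
Qed.

Lemma curve_length_mirror (s a b : R) gamma :
  curve_length g (s - b) (s - a) (gamma \o mirror s) = curve_length g a b gamma.
Proof. by rewrite !curve_lengthE -(mirror_itv s a b) ecurve_length_mirror. Qed.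

Lemma ecurve_length_ge0 (D : set R) gamma : (0 <= ecurve_length D gamma)%E.
Proof. by apply: integral_ge0 => t _; rewrite lee_fin sqrtr_ge0. Qed.

Lemma ecurve_length_set0 gamma : ecurve_length set0 gamma = 0%E.
Proof. exact: integral_set0. Qed.

(** The list [l] holds the exceptional times, such as ends of intervals, where the two-sided
    derivative of a concatenation need not match that of a piece; it is a null set. *)
Lemma ecurve_length_cover (D A B D1 D2 : set R) (l : seq R)
    gamma gamma1 gamma2 :
  measurable (A : set (measurableTypeR R)) ->
  measurable (B : set (measurableTypeR R)) ->
  D `<=` A `|` B `|` [set` l] -> A `<=` D1 -> B `<=` D2 ->
  (forall t, A t -> speed g gamma t = speed g gamma1 t) ->
  (forall t, B t -> speed g gamma t = speed g gamma2 t) ->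
  (ecurve_length D gamma <=
   ecurve_length D1 gamma1 + ecurve_length D2 gamma2)%E.
Proof.
move=> mA mB DABl AD1 BD2 s1 s2.
have speed0 g0 t : (0 <= (speed g g0 t)%:E)%E by rewrite lee_fin sqrtr_ge0.
have cl : countable [set` l] by exact/finite_set_countable/finite_seq.
have ml : measurable ([set` l] : set (measurableTypeR R)).
  apply: (@countable_measurable _ (measurableTypeR R) _ _ cl) => t.
  exact: measurable_set1.
have cover := @ge0_lower_integral_cover _ (measurableTypeR R) R
  (@lebesgue_measure R) D A B [set` l] D1 D2 _ _ _
  (speed0 gamma) (speed0 gamma1) (speed0 gamma2)
  mA mB ml (countable_lebesgue_measure0 cl) DABl AD1 BD2.
apply: cover.
- by move=> t At; rewrite s1.
- by move=> t Bt; rewrite s2.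
Qed.

(** Speeds are compared on the open intervals only, where the concatenation agrees with one curve in
    a whole neighbourhood; [a], [b], [c] are discarded as a null set. *)
Lemma curve_length_concat (a b c : R) gamma1 gamma2 : a <= b -> b <= c ->
  curve_length g a c (fun t => if t <= b then gamma1 t else gamma2 t) <=
  curve_length g a b gamma1 + curve_length g b c gamma2.
Proof.
move=> ab bc; set gamma := fun t => _.
pose I u v := ecurve_length `[u, v].
have s1 t : `]a, b[%classic t -> speed g gamma t = speed g gamma1 t.
  rewrite /= in_itv /= => /andP[_ tb]; apply: near_eq_speed.
  by apply: filterS (lt_nbhsl tb) => u ub; rewrite /gamma ltW.
have s2 t : `]b, c[%classic t -> speed g gamma t = speed g gamma2 t.
  rewrite /= in_itv /= => /andP[tb _]; apply: near_eq_speed.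
  by apply: filterS (lt_nbhsr tb) => u bu; rewrite /gamma leNgt bu.
have split_itv (u v t : R) : u <= t <= v -> u < t < v \/ t \in [:: u; v].
  move=> /andP[]; rewrite !inE le_eqVlt => /orP[/eqP->|ut].
    by rewrite eqxx; right.
  by rewrite ut le_eqVlt => /orP[->|tv]; [rewrite orbT; right|left].
have sub_itv (u v u' v' : R) : u' <= u -> v <= v' -> `]u, v[ `<=` `[u', v'].
  move=> u'u vv' t; rewrite /= !in_itv /= => /andP[/ltW ut /ltW tv].
  by rewrite (le_trans u'u ut) (le_trans tv vv').
have Ile : (I a c gamma <= I a b gamma1 + I b c gamma2)%E.
  apply: (@ecurve_length_cover _ `]a, b[ `]b, c[ _ _ [:: a; b; c])
    => //; try exact: sub_itv.
  move=> t; rewrite /= !in_itv /= => act.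
  have [tb|bt] := leP t b.
    have := split_itv a b t; case/andP: act => -> _ /(_ tb)[].
      by left; left.
    by rewrite !inE => /orP[] ->; right; rewrite ?orbT.
  have := split_itv b c t; case/andP: act => _ -> /(_ _)[].
  - by rewrite ltW.
  - by case/andP=> _ tc; left; right.
  - by rewrite !inE => /orP[] ->; right; rewrite ?orbT.
(* [I1] and [I2] exclude that a summand is infinite, with junk value
   [fine +oo = 0], while the whole length is not. *)
have I1 : (I a b gamma1 <= I a c gamma)%E.
  rewrite -[leRHS]adde0 -(ecurve_length_set0 gamma).
  apply: (@ecurve_length_cover _ `]a, b[ set0 _ _ [:: a; b]).
  - exact: measurable_itv.
  - exact: measurable0.
  - move=> t; rewrite /= !in_itv /=.
    by move=> /split_itv[uv|tuv]; [left; left|right].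
  - by apply: sub_itv; rewrite ?lexx.
  - exact: sub0set.
  - by move=> t ht; rewrite s1.
  - by move=> t [].
have I2 : (I b c gamma2 <= I a c gamma)%E.
  rewrite -[leRHS]adde0 -(ecurve_length_set0 gamma).
  apply: (@ecurve_length_cover _ `]b, c[ set0 _ _ [:: b; c]).
  - exact: measurable_itv.
  - exact: measurable0.
  - move=> t; rewrite /= !in_itv /=.
    by move=> /split_itv[uv|tuv]; [left; left|right].
  - by apply: sub_itv; rewrite ?lexx.
  - exact: sub0set.
  - by move=> t ht; rewrite s2.
  - by move=> t [].
have I0 u v gamma0 : (0 <= I u v gamma0)%E by exact: ecurve_length_ge0.
rewrite !curve_lengthE -!/(I _ _ _).
move: (I0 a c gamma) (I0 a b gamma1) (I0 b c gamma2) Ile I1 I2.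
case: (I a c gamma) => [r| |]; case: (I a b gamma1) => [r1| |];
  case: (I b c gamma2) => [r2| |] //= _ r10 r20 Ile I1 I2;
  by rewrite ?addr0 ?add0r -?lee_fin ?EFinD ?adde_ge0.
Qed.

Definition lengths x y : set R := [set l | exists a b gamma,
  [/\ a <= b, piecewise_C1_curve a b gamma, gamma a = x, gamma b = y
    & l = curve_length g a b gamma]].

Lemma lengths_ge0 x y : lbound (lengths x y) 0.
Proof. by move=> _ [a [b [gamma [_ _ _ _ ->]]]]; exact: curve_length_ge0. Qed.

Lemma lengthsC x y : lengths x y `<=` lengths y x.
Proof.
move=> _ [a [b [gamma [ab pg gx gy ->]]]].
exists (a + b - b), (a + b - a), (gamma \o mirror (a + b)).
split.
- by rewrite lerD2l lerN2.
- exact: piecewise_C1_curve_mirror.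
- by rewrite /= /mirror subKr.
- by rewrite /= /mirror subKr.
- by rewrite curve_length_mirror.
Qed.

Lemma intrinsic_distC x y : intrinsic_dist g x y = intrinsic_dist g y x.
Proof.
rewrite /intrinsic_dist -/(lengths x y) -/(lengths y x).
rewrite (_ : lengths x y = lengths y x)//.
by apply/seteqP; split; exact: lengthsC.
Qed.

Lemma lengths_concat x y z l1 l2 : lengths x y l1 -> lengths y z l2 ->
  exists2 l, lengths x z l & l <= l1 + l2.
Proof.
move=> [a [b [gamma1 [ab p1 g1x g1y ->]]]] /lengthsC.
move=> [c [d [gamma2 [cd p2 g2z g2y ->]]]].
(* The second curve has been reversed by [lengthsC]; reflecting it once more with [s = b + d]
   restores its direction and makes it start at time [b]. Two reflections thus replace a
   translation. *)
set e := b + d - c.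
have be : b <= e by rewrite /e; lra.
pose gamma3 := gamma2 \o mirror (b + d).
have bE : b + d - d = b by ring.
have p3 : piecewise_C1_curve b e gamma3.
  by rewrite -[X in piecewise_C1_curve X]bE; exact: piecewise_C1_curve_mirror.
have l3 : curve_length g b e gamma3 = curve_length g c d gamma2.
  by rewrite -[X in curve_length _ X _]bE; exact: curve_length_mirror.
have g3b : gamma3 b = y by rewrite /gamma3 /= /mirror addrC addKr.
have g3e : gamma3 e = z by rewrite /gamma3 /= /e /mirror subKr.
clearbody e gamma3; pose gamma t := if t <= b then gamma1 t else gamma3 t.
exists (curve_length g a e gamma).
  exists a, e, gamma; split.
  - exact: le_trans ab be.
  - by apply: piecewise_C1_curve_concat ab be _ p1 p3; rewrite g3b.
  - by rewrite /gamma ab.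
  (* If the second curve is defined on a single point, then [e = b] and [gamma] takes its value from
     [gamma1]. *)
  - rewrite /gamma; case: ifPn => [eb|//].
    have eE : e = b by apply/le_anti; rewrite eb be.
    by rewrite -g3e eE g3b g1y.
  - exact: erefl.
by rewrite -l3; exact: curve_length_concat.
Qed.

(** The nonemptiness hypotheses guard against [inf set0 = 0], which would put points without a
    joining curve at distance 0. *)
Lemma intrinsic_dist_triangle x y z :
  lengths x y !=set0 -> lengths y z !=set0 ->
  intrinsic_dist g x z <= intrinsic_dist g x y + intrinsic_dist g y z.
Proof.
move=> n1 n2; apply/ler_addgt0Pr => e e0.
have e20 : 0 < e / 2 by rewrite divr_gt0.
have hinf u v : lengths u v !=set0 -> has_inf (lengths u v).
  by move=> ?; split=> //; exists 0; exact: lengths_ge0.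
have [l1 h1 le1] := inf_adherent e20 (hinf _ _ n1).
have [l2 h2 le2] := inf_adherent e20 (hinf _ _ n2).
have [l hl lle] := lengths_concat h1 h2.
have : intrinsic_dist g x z <= l.
  by apply: ge_inf => //; exists 0; exact: lengths_ge0.
rewrite /intrinsic_dist -/(lengths x y) -/(lengths y z) -/(lengths x z); lra.
Qed.

End length.

(** * Scaling a Riemannian metric *)

Section Ck_scaling.
Context {R : realType} {V W : normedModType R}.
Implicit Types (F G : V -> W) (U : set V).

Lemma near_eq_differentiable F G (x : V) :
  {near x, F =1 G} -> differentiable F x -> differentiable G x.
Proof.
move=> FG dF; have [cF eF] := (diff_locallyP x F).1 dF.
have eG : G \o shift x = cst (G x) + 'd F x +o_ 0 id.
  apply/eqaddoP => e e0; move/eqaddoP: eF => /(_ e e0).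
  have : \forall h \near 0, F (h + x) = G (h + x).
    by move: FG; rewrite (near_shift 0 x) /= subr0.
  apply: filterS2 => h /= eh.
  by rewrite !fctE /= eh (nbhs_singleton FG).
have dG : 'd G x = 'd F x :> (V -> W) := diff_unique cF eG.
by apply/diff_locallyP; rewrite dG; split.
Qed.

(** Openness of [U] lets equality on [U] pass to derivatives. In [CkZ] this is what the induction
    needs, because ['D_v] commutes with scaling only where [F] is known to be derivable. *)
Lemma Ck_eq k U F G : open U -> (forall x, U x -> F x = G x) ->
  Ck k U F -> Ck k U G.
Proof.
move=> oU; have near_eq F' G' x : (forall x, U x -> F' x = G' x) -> U x ->
    {near x, F' =1 G'}.
  by move=> FG Ux; apply: filterS (open_nbhs_nbhs (conj oU Ux)) => y /FG.
elim: k F G => [|k IH] F G FG /= => [cF x Ux|[dF kF]].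
  have FGx := near_eq _ _ _ FG Ux.
  rewrite /prop_for /continuous_at -(FG x Ux).
  by apply: cvg_trans (cF x Ux); exact: near_eq_cvg.
split=> [x Ux|v].
  exact: near_eq_differentiable (near_eq _ _ _ FG Ux) (dF x Ux).
apply: IH (kF v) => x Ux; apply: near_eq_derive; exact: near_eq.
Qed.

Lemma CkZ k U F (c : R) : open U -> Ck k U F -> Ck k U (fun x => c *: F x).
Proof.
move=> oU; elim: k F => [|k IH] F /= => [cF x Ux|[dF kF]].
  exact: cvgZr (cF x Ux).
split=> [x Ux|v]; first exact/differentiableZ/dF.
apply: Ck_eq (IH _ (kF v)) => // x Ux.
by rewrite -deriveZ//; exact/diff_derivable/dF.
Qed.

End Ck_scaling.

Section scaled_metric.
Context {R : realType} {n : nat} {X : manifold R n} (g : riemannian X).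
Variables (k : R) (k0 : 0 < k).

Lemma qformZ (c : R) (A : 'M[R]_n) u v : qform (c *: A) u v = c * qform A u v.
Proof. by rewrite /qform -scalemxAr -scalemxAl mxE. Qed.

(** The square turns into a factor [k] under the root in [speed]. The definition is transparent so
    that [gmat] unfolds there. *)
Definition scaled_riemannian : riemannian X.
Proof.
refine (@Riemannian R n X (fun c x => k ^+ 2 *: gmat g c x) _ _ _ _).
- move=> c ac x cx; have [F [U [oU Ux CF eqF]]] := gmat_smooth g ac cx.
  exists (fun x => k ^+ 2 *: F x), U; split=> // [j|y Sy Uy].
    exact: CkZ (CF j).
  by rewrite eqF.
- by move=> c x ac cx; rewrite linearZ /= gmat_sym.
- by move=> c x u ac cx u0; rewrite qformZ mulr_gt0 ?exprn_gt0// gmat_pos.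
- move=> c c' x F ac ac' ox extF u v.
  by rewrite !qformZ (gmat_compat g ac ac' ox extF).
Defined.

Lemma speed_scaled (gamma : R -> X) t :
  speed scaled_riemannian gamma t = k * speed g gamma t.
Proof.
by rewrite /speed qformZ sqrtrM ?exprn_ge0 ?(ltW k0)// sqrtr_sqr gtr0_norm.
Qed.

Lemma curve_length_scaled (a b : R) (gamma : R -> X) :
  curve_length scaled_riemannian a b gamma = k * curve_length g a b gamma.
Proof.
have speed0 t : (0 <= (speed g gamma t)%:E)%E by rewrite lee_fin sqrtr_ge0.
have zE := @ge0_lower_integralZl _ (measurableTypeR R) R (@lebesgue_measure R)
  `[a, b]%classic _ k k0 speed0.
rewrite !curve_lengthE -[k in RHS]/(fine k%:E).
rewrite (_ : ecurve_length scaled_riemannian _ _ =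
  k%:E * ecurve_length g `[a, b] gamma)%E; last first.
  by rewrite -zE; apply: eq_integral => t _; rewrite speed_scaled EFinM.
have := ecurve_length_ge0 g `[a, b] gamma.
case: (ecurve_length g `[a, b] gamma) => [r| |] //= _.
(* An infinite integral stays infinite after scaling, and both lengths take the default value 0. *)
by rewrite gt0_muley ?lte_fin//= mulr0.
Qed.

Lemma intrinsic_dist_scaled (x y : X) :
  intrinsic_dist scaled_riemannian x y = k * intrinsic_dist g x y.
Proof.
rewrite /intrinsic_dist -/(lengths scaled_riemannian x y) -/(lengths g x y).
have lE : lengths scaled_riemannian x y = [set k * l | l in lengths g x y].
  apply/seteqP; split => [_ [a [b [gamma [ab p gx gy ->]]]]|].
    exists (curve_length g a b gamma); last by rewrite curve_length_scaled.
    by exists a, b, gamma.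
  move=> _ [_ [a [b [gamma [ab p gx gy ->]]]] <-].
  by exists a, b, gamma; rewrite curve_length_scaled.
rewrite lE; have [->|/set0P ne] := eqVneq (lengths g x y) set0.
  by rewrite image_set0 inf0 mulr0.
have lb : has_inf (lengths g x y) by split=> //; exists 0; exact: lengths_ge0.
apply/eqP; rewrite eq_le; apply/andP; split.
  rewrite -ler_pdivrMl//; apply: lb_le_inf => // l ll.
  rewrite ler_pdivrMl//; apply: ge_inf; last by exists l.
  exists 0 => _ [l' ll' <-]; rewrite mulr_ge0 ?(ltW k0)//.
  exact: lengths_ge0 ll'.
apply: lb_le_inf => [|_ [l ll <-]].
  by case: ne => l ll; exists (k * l), l.
by rewrite ler_pM2l//; apply: ge_inf => //; exists 0; exact: lengths_ge0.
Qed.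

End scaled_metric.

(** * Adding shortcuts to a metric *)

Section metric_on_theory.
Context {R : realType} {T : Type} (d : metric_on R T).

Lemma mfun_ge0 x y : 0 <= d x y.
Proof.
by have := mfun_triangle d y x x; rewrite mfunxx (mfunC d y x); lra.
Qed.

(** Zorn's lemma applies because two points of a union of a chain lie in a common member. A point at
    distance at least [e] from a maximal separated set could be added to it. *)
Lemma exists_separated_net (e : R) : 0 < e ->
  exists N : set T, (forall p q, N p -> N q -> d p q < e -> p = q) /\
    forall x, exists2 p, N p & d x p < e.
Proof.
move=> e0; pose sep (N : set T) := forall p q, N p -> N q -> d p q < e -> p = q.
have [F FP totF|N [sepN maxN]] := @Zorn_bigcup T sep.
  move=> p q [A FA Ap] [B FB Bq]; have [AB|BA] := totF _ _ FA FB.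
    by apply: (FP _ FB) => //; exact: AB.
  by apply: (FP _ FA) => //; exact: BA.
exists N; split=> // x; apply: contrapT => far.
have farx p : N p -> ~~ (d x p < e).
  by move=> Np; apply/negP => xp; apply: far; exists p.
apply: (maxN (N `|` [set x])).
  split; first exact: subsetUl.
  move=> sub; apply: far; exists x; last by rewrite mfunxx.
  by apply: sub; right.
move=> p q [Np|->] [Nq|->] //; first exact: sepN.
  by rewrite mfunC (negbTE (farx _ Np)).
by rewrite (negbTE (farx _ Nq)).
Qed.

End metric_on_theory.

(* The metric L with shortcuts of length d between the points of N. The trivial
   jumps [p = q] account for L itself. *)
Section shortcut.
Context {R : realType} {T : Type} (d L : metric_on R T) (K e : R) (N : set T).
Hypothesis dL : forall x y, d x y <= L x y.
Hypothesis LK : forall x y, L x y <= K * d x y.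
Hypothesis sepN : forall p q, N p -> N q -> d p q < e -> p = q.

Let jump p q := p = q \/ N p /\ N q.

(** The largest metric below the given bounds is in general an infimum over chains of arbitrary
    length; here chains with one jump suffice, by [shortcuts_triangle]. *)
Definition shortcuts x y : set R :=
  [set r | exists p q, jump p q /\ r = L x p + d p q + L q y].

Definition shortcut_fun x y : R := inf (shortcuts x y).

Lemma shortcuts_ge x y r : shortcuts x y r -> d x y <= r.
Proof.
move=> [p [q [_ ->]]].
have := mfun_triangle d p x y; have := mfun_triangle d q p y.
have := dL x p; have := dL q y; lra.
Qed.

Lemma shortcuts_direct x y : shortcuts x y (L x y).
Proof. by exists x, x; rewrite !mfunxx !add0r; split=> //; left. Qed.

Lemma has_inf_shortcuts x y : has_inf (shortcuts x y).
Proof.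
split; first by exists (L x y); exact: shortcuts_direct.
by exists (d x y) => r; exact: shortcuts_ge.
Qed.

Lemma shortcut_fun_le x y r : shortcuts x y r -> shortcut_fun x y <= r.
Proof. by move=> xyr; apply: ge_inf => //; case: (has_inf_shortcuts x y). Qed.

Lemma shortcut_ge x y : d x y <= shortcut_fun x y.
Proof.
apply: lb_le_inf => [|r]; first by case: (has_inf_shortcuts x y).
exact: shortcuts_ge.
Qed.

Lemma shortcut_le x y : shortcut_fun x y <= L x y.
Proof. exact/shortcut_fun_le/shortcuts_direct. Qed.

Lemma shortcutsC x y : shortcuts x y `<=` shortcuts y x.
Proof.
move=> r [p [q [pq ->]]]; exists q, p; split.
  by case: pq => [->|[]]; [left|right].
by rewrite (mfunC L x p) (mfunC d p q) (mfunC L q y); ring.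
Qed.

(** The walk from [q] to [p'] between two genuine jumps costs [L q p'], which is at least [d q p'];
    hence the jumps and the walk merge into the single jump from [p] to [q']. A trivial jump is
    absorbed into the adjacent walks. *)
Lemma shortcuts_triangle x y z r s : shortcuts x y r -> shortcuts y z s ->
  exists2 t, shortcuts x z t & t <= r + s.
Proof.
move=> [p [q [pq ->]]] [p' [q' [pq' ->]]].
have := mfun_triangle L y q p'; have := dL q p'.
case: pq => [<-|[Np Nq]].
  exists (L x p' + d p' q' + L q' z); first by exists p', q'.
  have := mfun_triangle L p x p'; rewrite mfunxx; lra.
case: pq' => [<-|[Np' Nq']].
  exists (L x p + d p q + L q z); first by exists p, q; split=> //; right.
  have := mfun_triangle L p' q z; rewrite mfunxx; lra.
exists (L x p + d p q' + L q' z); first by exists p, q'; split=> //; right.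
have := mfun_triangle d q p q'; have := mfun_triangle d p' q q'; lra.
Qed.

Fact shortcutxx x : shortcut_fun x x = 0.
Proof.
apply/eqP.
by rewrite eq_le -{1}(mfunxx L x) shortcut_le -(mfunxx d x) shortcut_ge.
Qed.

Fact shortcut_pos x y : shortcut_fun x y = 0 -> x = y.
Proof.
move=> xy0; apply: (@mfun_pos _ _ d); apply/eqP.
by rewrite eq_le mfun_ge0 -xy0 shortcut_ge.
Qed.

Fact shortcutC x y : shortcut_fun x y = shortcut_fun y x.
Proof.
by congr inf; apply/seteqP; split; exact: shortcutsC.
Qed.

Fact shortcut_triangle y x z :
  shortcut_fun x z <= shortcut_fun x y + shortcut_fun y z.
Proof.
apply/ler_addgt0Pr => a a0; have a20 : 0 < a / 2 by rewrite divr_gt0.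
have [r xyr ler] := inf_adherent a20 (has_inf_shortcuts x y).
have [s yzs les] := inf_adherent a20 (has_inf_shortcuts y z).
have [t xzt tle] := shortcuts_triangle xyr yzs.
by have := shortcut_fun_le xzt; rewrite /shortcut_fun; lra.
Qed.

Definition shortcut : metric_on R T :=
  MetricOn shortcutxx shortcut_pos shortcutC shortcut_triangle.

Lemma shortcut_small x y : shortcut x y < e -> shortcut x y = L x y.
Proof.
move=> xye; apply/eqP; rewrite eq_le shortcut_le /= leNgt; apply/negP => lt.
(* This slack yields a competitor shorter than both [e], which forces its jump to be trivial, and
   [L x y], which a trivial jump cannot beat. *)
have m0 : 0 < Num.min e (L x y) - shortcut_fun x y.
  by rewrite subr_gt0 lt_min xye.
have [r [p [q [pq ->]]]] := inf_adherent m0 (has_inf_shortcuts x y).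
rewrite -/(shortcut_fun x y) [ltRHS]addrC subrK lt_min => /andP[re rL].
have qp : q = p.
  case: pq => [->//|[Np Nq]]; apply/esym/sepN => //.
  by have := mfun_ge0 L x p; have := mfun_ge0 L q y; lra.
by move: rL; have := mfun_triangle L p x y; rewrite qp mfunxx; lra.
Qed.

Lemma id_local_isometry_shortcut : 0 < e -> id_local_isometry L shortcut.
Proof.
(* Half of [e], so that any two points of the ball are at [L]-distance below [e]. *)
move=> e0 x; exists (e / 2); first by rewrite divr_gt0.
have lt_e2 (r : R) : r < e / 2 -> r < e by lra.
split=> [|y z xy xz].
  apply/seteqP; split => y /=; first exact: le_lt_trans (shortcut_le x y).
  by move=> xy; rewrite -shortcut_small// lt_e2.
apply: shortcut_small; apply: le_lt_trans (shortcut_le y z) _.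
by have := mfun_triangle L x y z; rewrite (mfunC L y x); lra.
Qed.

(** Each walk to a nearby net point costs at most [K * e], and replacing [d x y] by the distance of
    the two net points costs at most [2 * e]. *)
Lemma shortcut_close x y : (forall z, exists2 p, N p & d z p < e) -> 0 <= K ->
  shortcut x y <= d x y + 2 * (1 + K) * e.
Proof.
move=> netN K0; have [p Np xp] := netN x; have [q Nq yq] := netN y.
have : shortcuts x y (L x p + d p q + L q y) by exists p, q; split=> //; right.
move=> /shortcut_fun_le; rewrite /= (mfunC L q y).
have : L x p <= K * e by apply: le_trans (LK x p) _; rewrite ler_wpM2l// ltW.
have : L y q <= K * e by apply: le_trans (LK y q) _; rewrite ler_wpM2l// ltW.
have := mfun_triangle d x p q; have := mfun_triangle d y x q.
rewrite (mfunC d p x); lra.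
Qed.

End shortcut.

(* The cost [eta + d] of crossing between the two copies of T satisfies the
   triangle inequalities because d <= d' <= d + 2 eta. *)
Section glue.
Context {R : realType} {T : Type} (d d' : metric_on R T) (eta : R).
Hypotheses (eta0 : 0 < eta) (dd' : forall x y, d x y <= d' x y).
Hypothesis d'd : forall x y, d' x y <= d x y + 2 * eta.

Definition glue_fun (u v : bool * T) : R :=
  if u.1 == v.1 then (if u.1 then d else d') u.2 v.2 else eta + d u.2 v.2.

Fact gluexx u : glue_fun u u = 0.
Proof. by rewrite /glue_fun eqxx; case: ifP => _; rewrite mfunxx. Qed.

Fact glue_pos u v : glue_fun u v = 0 -> u = v.
Proof.
case: u v => [b x] [c y]; rewrite /glue_fun /=; case: eqP => [<-|_].
  by case: b => h; rewrite (mfun_pos h).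
by have := ltr_wpDr (mfun_ge0 d x y) eta0 => + h; rewrite h ltxx.
Qed.

Fact glueC u v : glue_fun u v = glue_fun v u.
Proof.
case: u v => [b x] [c y]; rewrite /glue_fun /= eq_sym.
by case: eqP => [->|_]; rewrite mfunC.
Qed.

Fact glue_triangle v u w : glue_fun u w <= glue_fun u v + glue_fun v w.
Proof.
case: u v w => [[] x] [[] y] [[] z]; rewrite /glue_fun /=; have := eta0;
  have := mfun_triangle d y x z; have := mfun_triangle d' y x z;
  have := dd' x y; have := dd' y z; have := d'd x z; lra.
Qed.

Definition glue : metric_on R (bool * T) :=
  MetricOn gluexx glue_pos glueC glue_triangle.

End glue.

(** * Gromov-Hausdorff approximation *)

Lemma ereal_inf_ge0 (R : realType) (S : set (\bar R)) :
  (forall r, S r -> (0 <= r)%E) -> (0 <= ereal_inf S)%E.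
Proof. by move=> S0; exact: le_ereal_inf_tmp. Qed.

Lemma hausdorff_dist_ge0 (R : realType) (Z : metricType R) (A B : set Z) :
  (0 <= hausdorff_dist A B)%E.
Proof. by apply: ereal_inf_ge0 => _ [r [r0 _ _] <-]; rewrite lee_fin ltW. Qed.

Lemma GH_dist_ge0 (R : realType) (A B : metricType R) : (0 <= GH_dist A B)%E.
Proof.
by apply: ereal_inf_ge0 => _ [Z [i [j [_ _ ->]]]]; exact: hausdorff_dist_ge0.
Qed.

Section GH.
Context {R : realType} {T : choiceType} (Y : metricType R).
Variables (d d' : metric_on R T) (f : T -> Y) (f' : Y -> T) (eta : R).
Hypotheses (ff' : cancel f' f) (df : forall x y, d x y = mdist (f x) (f y)).
Hypotheses (eta0 : 0 < eta) (dd' : forall x y, d x y <= d' x y).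
Hypothesis d'd : forall x y, d' x y <= d x y + 2 * eta.

Lemma GH_dist_le : (GH_dist (metrized d') Y <= (2 * eta)%:E)%E.
Proof.
pose Z : metricType R := metrized (glue eta0 dd' d'd).
pose i (x : metrized d') : Z := (false, x).
pose j (y : Y) : Z := (true, f' y).
have dij x y : mdist (i x) (j y) = eta + d x (f' y) by [].
have f'f x : f' (f x) = x.
  by apply: (@mfun_pos _ _ d); rewrite df ff' mdistxx.
apply: (@le_trans _ _ (hausdorff_dist (range i) (range j))).
  apply: ereal_inf_lbound; exists Z, i, j; split=> // x y.
  by rewrite -[RHS](congr2 mdist (ff' x) (ff' y)) -df.
(* Corresponding points of the two copies are at distance exactly [eta]; the strict inequality in
   [hausdorff_dist] asks for a larger radius. *)
apply: ereal_inf_lbound; exists (2 * eta) => //; split.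
- by rewrite mulr_gt0.
- move=> _ [x _ <-]; exists (j (f x)); first by exists (f x).
  by rewrite dij f'f mfunxx; have := eta0; lra.
- move=> _ [y _ <-]; exists (i (f' y)); first by exists (f' y).
  by rewrite dij mfunxx; have := eta0; lra.
Qed.

End GH.

Lemma dist_continuous_lipschitz (R : realType) (A B : Type) (dA : A -> A -> R)
    (dB : B -> B -> R) (c : R) (f : A -> B) : 0 < c ->
  (forall x y, dB (f x) (f y) <= c * dA x y) -> dist_continuous dA dB f.
Proof.
move=> c0 fc x e e0; exists (e / c); first by rewrite divr_gt0.
move=> y xy; apply: le_lt_trans (fc _ _) _.
by rewrite mulrC -ltr_pdivlMr.
Qed.

(** * The metrics on X induced by a bi-Lipschitz map *)

Section pullback.
Context {R : realType} {n : nat} {X : manifold R n} (g : riemannian X).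
Context (Y : metricType R) (lambda : R) (f : X -> Y).
Hypotheses (lambda0 : 0 < lambda) (finj : injective f).
Hypothesis fbil : forall x y, lambda^-1 * intrinsic_dist g x y <=
  mdist (f x) (f y) <= lambda * intrinsic_dist g x y.

Definition pullback_metric : metric_on R X.
Proof.
refine (@MetricOn R X (fun x y => mdist (f x) (f y)) _ _ _ _).
- by move=> x; rewrite mdistxx.
- by move=> x y /mdist_positivity; exact: finj.
- by move=> x y; rewrite metric_sym.
- by move=> y x z; exact: metric_triangle.
Defined.

Lemma intrinsic_dist_ge0 x y : 0 <= intrinsic_dist g x y.
Proof.
have /andP[_] := fbil x y; move=> /(le_trans (mdist_ge0 _ _)).
by rewrite pmulr_rge0.
Qed.

Lemma intrinsic_distxx x : intrinsic_dist g x x = 0.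
Proof.
have /andP[+ _] := fbil x x; rewrite mdistxx pmulr_rle0 ?invr_gt0// => h.
by apply/eqP; rewrite eq_le h intrinsic_dist_ge0.
Qed.

Lemma intrinsic_dist_eq0 x y : intrinsic_dist g x y = 0 -> x = y.
Proof.
have /andP[_ +] := fbil x y => + h; rewrite h mulr0 => h'.
by apply/finj/mdist_positivity/eqP; rewrite eq_le h' mdist_ge0.
Qed.

(* [inf] of the empty set is 0, so distinct points are joined by a curve. *)
Lemma lengths_neq0 x y : x <> y -> lengths g x y !=set0.
Proof.
move=> xy; apply/set0P/eqP => l0; apply/xy/intrinsic_dist_eq0.
by rewrite /intrinsic_dist -/(lengths g x y) l0 inf0.
Qed.

Definition scaled_intrinsic_metric : metric_on R X.
Proof.
refine (@MetricOn R X (intrinsic_dist (scaled_riemannian g lambda0)) _ _ _ _).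
- by move=> x; rewrite intrinsic_dist_scaled intrinsic_distxx mulr0.
- move=> x y; rewrite intrinsic_dist_scaled => /eqP; rewrite mulf_eq0 gt_eqF//=.
  by move=> /eqP; exact: intrinsic_dist_eq0.
- by move=> x y; exact: intrinsic_distC.
- move=> y x z; rewrite !intrinsic_dist_scaled -mulrDr ler_pM2l//.
  (* Coinciding points are treated apart because [lengths_neq0] provides curves between distinct
     points only. *)
  have [->|xy] := pselect (x = y); first by rewrite intrinsic_distxx add0r.
  have [->|yz] := pselect (y = z); first by rewrite intrinsic_distxx addr0.
  by apply: intrinsic_dist_triangle; exact: lengths_neq0.
Defined.

End pullback.

Theorem theorem1p11 (R : realType) (lambda : R) (hlambda : 1 <= lambda) :
  exists2 lambda' : R, 1 <= lambda' &
    forall (X : manifold R 2) (g : riemannian X), compact [set: X] ->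
      forall Y : metricType R, BL (intrinsic_dist g) lambda Y ->
        GH_closure (fun Z => Rloc X Z /\ BL (intrinsic_dist g) lambda' Z) Y.
Proof.
exists lambda => // X g _ Y [f [[f' [fK f'K _ _]] fbil]].
have lambda0 : 0 < lambda by exact: lt_le_trans hlambda.
pose d := pullback_metric (can_inj fK).
pose L := scaled_intrinsic_metric lambda0 (can_inj fK) fbil.
have LE x y : L x y = lambda * intrinsic_dist g x y.
  exact: intrinsic_dist_scaled.
have dL x y : d x y <= L x y by rewrite LE; have /andP[] := fbil x y.
have gd x y : lambda^-1 * intrinsic_dist g x y <= d x y.
  by have /andP[] := fbil x y.
have LK x y : L x y <= lambda ^+ 2 * d x y.
  by rewrite LE expr2 -mulrA ler_pM2l// -ler_pdivrMl.
pose e k : R := k.+1%:R^-1.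
have e0 k : 0 < e k by rewrite invr_gt0.
(* Half of the error in [shortcut_close] with [K = lambda ^+ 2], as gluing allows an error of
   [2 * eta]. *)
pose eta k : R := (1 + lambda ^+ 2) * e k.
have eta0 k : 0 < eta k by rewrite mulr_gt0// addr_gt0// exprn_gt0.
pose N k := sval (cid (exists_separated_net d (e0 k))).
have sepN k : forall p q, N k p -> N k q -> d p q < e k -> p = q.
  by rewrite /N; case: cid => /= ? [].
have netN k : forall x, exists2 p, N k p & d x p < e k.
  by rewrite /N; case: cid => /= ? [].
pose d' k := shortcut (N k) dL.
have dd' k x y : d x y <= d' k x y by exact: shortcut_ge.
have d'L k x y : d' k x y <= L x y by exact: shortcut_le.
exists (fun k => metrized (d' k)); split=> [k|].
  split.
    exists (d' k); split=> //; exists (scaled_riemannian g lambda0).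
    exact: (id_local_isometry_shortcut dL (sepN k)).
  have bil x y : lambda^-1 * intrinsic_dist g x y <= d' k x y <=
      lambda * intrinsic_dist g x y.
    apply/andP; split; first exact: le_trans (gd x y) (dd' k x y).
    by rewrite -LE; exact: d'L.
  (* The space [metrized (d' k)] has the points of X, so the identity is the required map; its
     continuity in both directions follows from the Lipschitz bounds. *)
  exists id; split=> //; exists id; split=> //.
    apply: (dist_continuous_lipschitz lambda0) => x y.
    by have /andP[] := bil x y.
  apply: (dist_continuous_lipschitz lambda0) => x y.
  by rewrite -ler_pdivrMl//; have /andP[] := bil x y.
apply: (@squeeze_cvge _ _ _ _ (fun=> 0%E) _ (fun k => (2 * eta k)%:E)).
- near=> k; rewrite GH_dist_ge0/=.
  apply: (@GH_dist_le _ _ _ d _ f f') => // x y.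
  rewrite mulrA; apply: shortcut_close => //.
  by rewrite exprn_ge0// ltW.
- exact: cvg_cst.
- apply: cvg_EFin; first by near=> k.
  rewrite -[X in _ --> X](mulr0 (2 * (1 + lambda ^+ 2))) /eta.
  under eq_fun do rewrite mulrA.
  by apply: cvgMr; exact: cvg_harmonic.
Unshelve. all: by end_near. Qed.
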